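(* Let $D\subset\mathbb{R}^n$ be a simply connected open set, let $F=(f_{ij})$ be a solution on $D$ of the $\frac{\mathrm{O}(2n-k,k)}{\mathrm{O}(n)\times\mathrm{O}(n-k,k)}$-system, and let $E$ be an extended frame for $F$. Then: (a) $E(x,0)=\begin{pmatrix} g_1(x)&0\\0&g_2(x)\end{pmatrix}$ with $g_1(x)\in\mathrm{O}(n)$ and $g_2(x)\in\mathrm{O}(n-k,k)$. (b) $\frac{\partial E}{\partial\lambda}E^{-1}\big|_{\lambda=0}$ is of the form $\begin{pmatrix}0&Y\\-JY^T&0\end{pmatrix}$ for some map $Y$ into real $n\times n$ matrices, and $\mathrm{d} Y=-\sum_{i=1}^n g_1e_{ii}Jg_2^{-1}\,\mathrm{d} x_i$. (c) If ${\vec{c}}\in\mathbb{R}^{n-k,k}$ is a constant null vector and $(u_1,\dots,u_n)^T:=Jg_2^{-1}{\vec{c}}$, then on the open set $\{x\in D:\prod_{i=1}^n u_i(x)\neq0\}$, $Y{\vec{c}}$ is a Guichard$_k$ orthogonal co-ordinate system on $\mathbb{R}^n$ whose induced metric is $\sum_{i=1}^n u_i^2\,\mathrm{d} x_i^2$. (d) If $\{{\vec{c}}_1,\dots,{\vec{c}}_n\}$ is a null basis of $\mathbb{R}^{n-k,k}$, then $\{Y{\vec{c}}_1,\dots,Y{\vec{c}}_n\}$ is a Combescure sequence of Guichard$_k$ orthogonal co-ordinate systems on $\mathbb{R}^n$. (e) If moreover $\{{\vec{b}}_1,\dots,{\vec{b}}_n\}$ is another null basis of $\mathbb{R}^{n-k,k}$,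 then $Y(x){\vec{c}}_i\mapsto Y(x){\vec{b}}_j$ is a Combescure transform for all $1\le i,j\le n$.
   Context: Fix integers $n\ge2$ and $1\le k\le n-1$. Let $\epsilon_i=1$ for $1\le i\le n-k$ and $\epsilon_i=-1$ for $n-k<i\le n$, $J=\mathrm{I}_{n-k,k}=\operatorname{diag}(\epsilon_1,\dots,\epsilon_n)$, and $(\vec x,\vec y)_k=\vec x^TJ\vec y$ on $\mathbb{R}^n$ (denoted $\mathbb{R}^{n-k,k}$) and on $\mathbb{C}^n$. A vector ${\vec{c}}$ is null if $({\vec{c}},{\vec{c}})_k=0$; a null basis of $\mathbb{R}^{n-k,k}$ is a basis consisting of null vectors. $\mathrm{O}(n-k,k)=\{g: g^TJg=J\}$. $e_{ii}$ is the $n\times n$ matrix with $1$ in entry $(i,i)$ and $0$ elsewhere; $\delta=\operatorname{diag}(\mathrm{d} x_1,\dots,\mathrm{d} x_n)$. Let $G=\operatorname{diag}(\mathrm{I}_n,J)$ ($2n\times 2n$); $\mathrm{O}(2n-k,k)^{\mathbb{C}}$ is the group of complex $2n\times2n$ matrices $A$ with $A^TGA=G$, and $\mathrm{I}_{n,n}=\operatorname{diag}(\mathrm{I}_n,-\mathrm{I}_n)$. The $\frac{\mathrm{O}(2n-k,k)}{\mathrm{O}(n)\times\mathrm{O}(n-k,k)}$-system is the PDE for a smooth map $F=(f_{ij})$ into real $n\times n$ matrices with $f_{ii}=0$ for all $i$, requiring that the $1$-forms $\omega=-\delta JF+F^TJ\delta$ and $\tau=-\delta F^TJ+F\delta J$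 are both flat ($\mathrm{d}\omega+\omega\wedge\omega=0$, $\mathrm{d}\tau+\tau\wedge\tau=0$); equivalently the family $\theta_\lambda=\begin{pmatrix}\omega&-\lambda\delta J\\ \lambda\delta&\tau\end{pmatrix}$ is flat for all $\lambda\in\mathbb{C}$. An extended frame for $F$ is a smooth map $E:D\times\mathbb{C}\to\mathrm{O}(2n-k,k)^{\mathbb{C}}$, holomorphic in $\lambda$, with $E(\cdot,\lambda)^{-1}\mathrm{d} E(\cdot,\lambda)=\theta_\lambda$ for all $\lambda$, satisfying $\overline{E(x,\bar\lambda)}=E(x,\lambda)$ and $\mathrm{I}_{n,n}E(x,-\lambda)\mathrm{I}_{n,n}^{-1}=E(x,\lambda)$. An orthogonal co-ordinate system on an open set $U\subset\mathbb{R}^n$ is a smooth map $\phi:U\to\mathbb{R}^n$ whose partial derivatives $\phi_{x_1},\dots,\phi_{x_n}$ are nonzero and mutually orthogonal at each point; a metric field for it is $\vec u=(u_1,\dots,u_n)^T$ with $\phi^*(\mathrm{d} s_0^2)=\sum u_i^2\mathrm{d} x_i^2$ ($\mathrm{d} s_0^2$ the Euclidean metric). A diagonal metric $\sum g_{ii}\mathrm{d} x_i^2$ is Guichard$_k$ if $\sum_{i=1}^{n-k}g_{ii}=\sum_{i=n-k+1}^n g_{ii}$; $\phi$ is Guichard$_k$ if $\phi^*(\mathrm{d} s_0^2)$ is. A map $\phi(x)\mapsto\psi(x)$ between orthogonal co-ordinate systems is a Combescure transform if $\phi_{x_i}(x)$ is parallel to $\psi_{x_i}(x)$ for all $i$ and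 $x$. A sequence $\{\phi_1,\dots,\phi_n\}$ of Guichard$_k$ orthogonal co-ordinate systems is a Combescure sequence if (i) each $\phi_i\mapsto\phi_{i+1}$ ($1\le i\le n-1$) is a Combescure transform and (ii) the metric fields $\vec u_i=(u_{i1},\dots,u_{in})^T$ of $\phi_i$, chosen so that $(\phi_i)_{x_j}/u_{ij}=(\phi_1)_{x_j}/u_{1j}$ for all $i,j$, are linearly independent at every point. *)

(* Defs.v *)
(* MathComp + MathComp-Analysis, over an abstract R : realType,
   complex numbers are R[i] (mathcomp-real-closed complex). *)
From HB Require Import structures.
From mathcomp Require Export all_boot all_order all_algebra.
From mathcomp Require Export all_classical all_reals all_analysis.
From mathcomp Require Export complex.
Export Order.TTheory GRing.Theory Num.Theory.
Export numFieldTopology.Exports numFieldNormedType.Exports.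

Unset Implicit Arguments.
Unset Strict Implicit.
Unset Printing Implicit Defensive.

Local Open Scope ring_scope.
Local Open Scope classical_set_scope.

Section Defs.
Variable R : realType.

(* Calculus on open subsets of R^m (points are row vectors 'rV[R]_m)   *)

(* i-th partial derivative  df/dx_i  (direction = i-th standard basis vector) *)
Definition pd {m : nat} {V : normedModType R} (i : 'I_m)
  (f : 'rV[R]_m -> V) : 'rV[R]_m -> V :=
  fun x => 'D_(delta_mx 0 i) f x.

(* iterated partial derivatives  d/dx_{i1} ... d/dx_{ir} f *)
Fixpoint iter_pd {m : nat} {V : normedModType R} (s : seq 'I_m)
  (f : 'rV[R]_m -> V) : 'rV[R]_m -> V :=
  match s with
  | [::] => f
  | i :: s' => pd i (iter_pd s' f)
  end.

(* f is smooth (C^infinity) on the (open) set U: every iterated partial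
   derivative of f is (Frechet) differentiable at every point of U. *)
Definition smooth_on {m : nat} {V : normedModType R} (U : set 'rV[R]_m)
  (f : 'rV[R]_m -> V) : Prop :=
  forall (s : seq 'I_m) (x : 'rV[R]_m), U x -> differentiable (iter_pd s f) x.

(* Simple connectedness                                                *)

Definition unit_interval : set R := [set t | 0 <= t <= 1].

Definition path_in {V : topologicalType} (D : set V) (g : R -> V) : Prop :=
  {within unit_interval, continuous g} /\
  (forall t, unit_interval t -> D (g t)).

(* D is nonempty, path connected, and every loop in D is null-homotopic in D
   (homotopy relative to the base point). *)
Definition simply_connected {V : topologicalType} (D : set V) : Prop :=
  D !=set0 /\
  (forall x y, D x -> D y -> exists g, path_in D g /\ g 0 = x /\ g 1 = y) /\
  (forall g : R -> V, path_in D g -> g 0 = g 1 ->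
     exists H : R * R -> V,
       {within unit_interval `*` unit_interval, continuous H} /\
       (forall p, (unit_interval `*` unit_interval) p -> D (H p)) /\
       (forall s, unit_interval s -> H (s, 0) = g s /\ H (s, 1) = g 0) /\
       (forall t, unit_interval t -> H (0, t) = g 0 /\ H (1, t) = g 0)).

(* Linear algebra data                                                 *)

(* J = I_{n-k,k} = diag(eps_1,...,eps_n), eps_i = 1 for i <= n-k (1-based),
   i.e. for 0-based index i < n-k, and -1 otherwise. *)
Definition Jmx (n k : nat) : 'M[R]_n :=
  diag_mx (\row_(i < n) (if (i < n - k)%N then 1 else -1)).

(* e_ii *)
Definition eii {n : nat} (i : 'I_n) : 'M[R]_n := delta_mx i i.

(* Euclidean inner product of column vectors *)
Definition dotv {n : nat} (v w : 'cV[R]_n) : R := (v^T *m w) 0 0.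

(* (x, y)_k = x^T J y *)
Definition formk (n k : nat) (v w : 'cV[R]_n) : R := (v^T *m Jmx n k *m w) 0 0.

Definition null_vector (n k : nat) (c : 'cV[R]_n) : Prop := formk n k c c = 0.

(* a null basis of R^{n-k,k}, given as an n-indexed family of vectors *)
Definition null_basis (n k : nat) (cs : 'I_n -> 'cV[R]_n) : Prop :=
  let M := \matrix_(i < n) (cs i)^T in
  row_free M /\ row_full M /\ (forall i, null_vector n k (cs i)).

(* O(n) and O(n-k,k) *)
Definition orthogonal_mx {n : nat} (g : 'M[R]_n) : Prop := g^T *m g = 1%:M.
Definition Opq_mx (n k : nat) (g : 'M[R]_n) : Prop :=
  g^T *m Jmx n k *m g = Jmx n k.

(* The O(2n-k,k)/(O(n) x O(n-k,k))-system                              *)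

(* omega = -delta J F + F^T J delta = sum_i omega_i dx_i *)
Definition omega_form (n k : nat) (F : 'rV[R]_n -> 'M[R]_n) (i : 'I_n) :
  'rV[R]_n -> 'M[R]_n :=
  fun x => - (eii i *m Jmx n k *m F x) + (F x)^T *m Jmx n k *m eii i.

(* tau = -delta F^T J + F delta J = sum_i tau_i dx_i *)
Definition tau_form (n k : nat) (F : 'rV[R]_n -> 'M[R]_n) (i : 'I_n) :
  'rV[R]_n -> 'M[R]_n :=
  fun x => - (eii i *m (F x)^T *m Jmx n k) + F x *m eii i *m Jmx n k.

(* A = sum_i A_i dx_i is flat on D:  dA + A /\ A = 0, i.e. for all i, j,
   d_i A_j - d_j A_i + A_i A_j - A_j A_i = 0 *)
Definition flat_on {n m : nat} (D : set 'rV[R]_n)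
  (A : 'I_n -> 'rV[R]_n -> 'M[R]_m) : Prop :=
  forall x, D x ->
    (forall i, differentiable (A i) x) /\
    (forall i j, pd i (A j) x - pd j (A i) x + A i x *m A j x - A j x *m A i x = 0).

Definition solves_system (n k : nat) (D : set 'rV[R]_n)
  (F : 'rV[R]_n -> 'M[R]_n) : Prop :=
  smooth_on D F /\
  (forall x, D x -> forall i, F x i i = 0) /\
  flat_on D (omega_form n k F) /\
  flat_on D (tau_form n k F).

(* Complex matrices and the extended frame                             *)

Definition cmx {p q : nat} (A : 'M[R]_(p, q)) : 'M[R[i]]_(p, q) :=
  map_mx (fun a : R => (a%:C)%C) A.
Definition ReM {p q : nat} (A : 'M[R[i]]_(p, q)) : 'M[R]_(p, q) :=
  map_mx (@complex.Re R) A.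
Definition ImM {p q : nat} (A : 'M[R[i]]_(p, q)) : 'M[R]_(p, q) :=
  map_mx (@complex.Im R) A.

(* partial derivative d/dx_i of a complex-matrix valued function of x in R^n,
   computed on real and imaginary parts *)
Definition pdC {n p q : nat} (i : 'I_n) (f : 'rV[R]_n -> 'M[R[i]]_(p, q))
  (x : 'rV[R]_n) : 'M[R[i]]_(p, q) :=
  cmx (pd i (fun y => ReM (f y)) x) + 'i%C *: cmx (pd i (fun y => ImM (f y)) x).

(* the point (x, lambda) of R^n x C = R^(n+2) *)
Definition xpart {n : nat} (p : 'rV[R]_(n + 2)) : 'rV[R]_n := lsubmx p.
Definition lpart {n : nat} (p : 'rV[R]_(n + 2)) : R[i] :=
  ((rsubmx p) 0 ord0 +i* (rsubmx p) 0 ord_max)%C.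

(* G = diag(I_n, J) and I_{n,n} *)
Definition Gmx (n k : nat) : 'M[R]_(n + n) := block_mx 1%:M 0 0 (Jmx n k).
Definition Inn (n : nat) : 'M[R]_(n + n) := block_mx 1%:M 0 0 (- 1%:M).

(* theta_lambda = sum_i theta_{lambda,i} dx_i *)
Definition theta (n k : nat) (F : 'rV[R]_n -> 'M[R]_n) (l : R[i]) (i : 'I_n)
  (x : 'rV[R]_n) : 'M[R[i]]_(n + n) :=
  block_mx (cmx (omega_form n k F i x)) (- l *: cmx (eii i *m Jmx n k))
           (l *: cmx (eii i)) (cmx (tau_form n k F i x)).

(* complex derivative in lambda *)
Definition holomorphic {p q : nat} (f : R[i]^o -> 'M[R[i]]_(p, q)) : Prop :=
  forall l : R[i]^o, derivable f l 1.

Definition extended_frame (n k : nat) (D : set 'rV[R]_n)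
  (F : 'rV[R]_n -> 'M[R]_n) (E : 'rV[R]_n -> R[i] -> 'M[R[i]]_(n + n)) : Prop :=
  (* smooth on D x C (real and imaginary parts, C = R^2) *)
  smooth_on [set p : 'rV[R]_(n + 2) | D (xpart p)]
    (fun p => ReM (E (xpart p) (lpart p))) /\
  smooth_on [set p : 'rV[R]_(n + 2) | D (xpart p)]
    (fun p => ImM (E (xpart p) (lpart p))) /\
  (* holomorphic in lambda *)
  (forall x, D x -> holomorphic (E x : R[i]^o -> 'M[R[i]]_(n + n))) /\
  (* values in O(2n-k,k)^C *)
  (forall x l, D x -> (E x l)^T *m cmx (Gmx n k) *m E x l = cmx (Gmx n k)) /\
  (* E^{-1} dE = theta_lambda *)
  (forall x l, D x -> forall i,
     invmx (E x l) *m pdC i (fun y => E y l) x = theta n k F l i x) /\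
  (* reality condition *)
  (forall x l, D x -> map_mx (fun z : R[i] => z^*) (E x (l^*)) = E x l) /\
  (* twisting condition *)
  (forall x l, D x -> cmx (Inn n) *m E x (- l) *m invmx (cmx (Inn n)) = E x l).

(* Orthogonal co-ordinate systems                                      *)

(* phi^*(ds_0^2) as the matrix of coefficients (g_ij) *)
Definition pullback_metric {n : nat} (phi : 'rV[R]_n -> 'cV[R]_n)
  (x : 'rV[R]_n) : 'M[R]_n :=
  \matrix_(i < n, j < n) dotv (pd i phi x) (pd j phi x).

Definition orth_coord {n : nat} (U : set 'rV[R]_n)
  (phi : 'rV[R]_n -> 'cV[R]_n) : Prop :=
  open U /\ smooth_on U phi /\
  (forall x, U x ->
     (forall i, pd i phi x != 0) /\
     (forall i j, i != j -> dotv (pd i phi x) (pd j phi x) = 0)).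

(* u is a metric field: phi^*(ds_0^2) = sum_i u_i^2 dx_i^2 *)
Definition metric_field {n : nat} (U : set 'rV[R]_n)
  (phi : 'rV[R]_n -> 'cV[R]_n) (u : 'rV[R]_n -> 'cV[R]_n) : Prop :=
  forall x, U x -> pullback_metric phi x = diag_mx (\row_(i < n) (u x i 0) ^+ 2).

(* Guichard_k diagonal metric *)
Definition guichard_metric (n k : nat) (g : 'M[R]_n) : Prop :=
  is_diag_mx g /\
  \sum_(i < n | (i < n - k)%N) g i i = \sum_(i < n | (n - k <= i)%N) g i i.

Definition guichard (n k : nat) (U : set 'rV[R]_n)
  (phi : 'rV[R]_n -> 'cV[R]_n) : Prop :=
  forall x, U x -> guichard_metric n k (pullback_metric phi x).

Definition parallel {n : nat} (v w : 'cV[R]_n) : Prop := exists a : R, w = a *: v.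

Definition combescure {n : nat} (U : set 'rV[R]_n)
  (phi psi : 'rV[R]_n -> 'cV[R]_n) : Prop :=
  orth_coord U phi /\ orth_coord U psi /\
  (forall x, U x -> forall i, parallel (pd i phi x) (pd i psi x)).

(* Combescure sequence {phi_1,...,phi_n} (indexed by 'I_n, 0-based) *)
Definition combescure_seq (n k : nat) (U : set 'rV[R]_n)
  (phis : 'I_n -> 'rV[R]_n -> 'cV[R]_n) : Prop :=
  (forall i, orth_coord U (phis i) /\ guichard n k U (phis i)) /\
  (forall i j : 'I_n, nat_of_ord j = (nat_of_ord i).+1 ->
     combescure U (phis i) (phis j)) /\
  (exists us : 'I_n -> 'rV[R]_n -> 'cV[R]_n,
     (forall i, metric_field U (phis i) (us i)) /\
     (forall (i i0 j : 'I_n) x, nat_of_ord i0 = 0%N -> U x ->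
        (us i x j 0)^-1 *: pd j (phis i) x = (us i0 x j 0)^-1 *: pd j (phis i0) x) /\
     (forall x, U x -> row_free (\matrix_(i < n) (us i x)^T))).

End Defs.

(* Main.v *)
(* Twisting and reality force E(x,0) to be real and block diagonal, and force the
   derivative A of E in lambda at 0 to be real and block off-diagonal; the orthogonality
   relation differentiated at lambda = 0 links the two off-diagonal blocks.  Exchanging
   d/dx_i and d/dlambda in d_i E = E theta_i gives d_i A = A theta_i(0) + E(x,0) K_i with
   K_i = d theta_i / d lambda, hence d_i Y = - g1 e_ii J g2^-1.  So d_i (Y c) is
   - u_i (i-th column of g1) with u = J g2^-1 c: the columns of g1 are orthonormal and
   do not depend on c, which gives orthogonality and the Combescure property, while
   u^T J u = c^T J c = 0 is the Guichard_k condition. *)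
Require Import Defs.
From mathcomp Require Import ring lra.
Set Implicit Arguments.
Unset Strict Implicit.
Local Open Scope ring_scope.
Local Open Scope classical_set_scope.

(** * Calculus of matrix-valued maps *)
Section MatrixCalculus.
Variables (R : realType) (V : normedModType R).

(** The mixed derivatives in x and lambda call for real calculus on R^n x C read as R^(n+2), whereas
    holomorphy speaks of a complex derivative. The computation is therefore made for real lambda
    only, where E is a real matrix, and the complex derivative at 0 is recovered from its value
    along the real axis. Exchanging derivatives rests on a form of Schwarz's theorem obtained from
    second differences. Y contains the inverse of g2; on O(n-k,k) that inverse is J g2^T J, so
    product and transpose rules suffice to differentiate it. Smoothness of Y is a bootstrap: g1 and
    g2 solve linear first-order systems with smooth coefficients, and dY is polynomial in g1 and g2.
    Since d_i (Y c) vanishes together with u_i, the co-ordinate systems live on the subset of D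
    where the relevant u_i are all non-zero; continuity of u makes it open. *)

Lemma differentiable_mxP (p q : nat) (f : V -> 'M[R]_(p, q)) (x : V) :
  differentiable f x <-> forall a b, differentiable (fun y => f y a b) x.
Proof.
split=> [df a b | df].
  exact: (differentiable_comp df (differentiable_coord _ _ _)).
have -> : f = \sum_(a < p) \sum_(b < q) (fun y => f y a b *: delta_mx a b).
  apply/funext => y; rewrite fct_sumE {1}[f y]matrix_sum_delta.
  by apply: eq_bigr => a _; rewrite fct_sumE.
apply: differentiable_sum => a; apply: differentiable_sum => b.
exact: differentiableZl.
Qed.

(** Differentiability depends only on the germ: the first-order expansion of [f] at [x] is one for
    [g] as well. It serves to replace expressions by formulas valid only on an open set, such as J
    g2^T J for the inverse of g2. *)
Lemma near_eq_differentiable (W : normedModType R) (f g : V -> W) (x : V) :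
  (\near x, f x = g x) -> differentiable f x -> differentiable g x.
Proof.
move=> fg df.
have [dfc fE] := (diff_locallyxP x f).1 df.
have gE : g \o shift x = cst (g x) + 'd f x +o_ 0 id.
  apply/eqaddoP => e e0.
  have /eqaddoP/(_ e e0) := diff_locally df.
  have fg0 : \forall h \near (0 : V), f (h + x) = g (h + x).
    rewrite (near_shift x 0) /=.
    by apply: filterS fg => y; rewrite /= sub0r subrK.
  apply: filterS2 fg0 => h fgh.
  by rewrite /= !fctE /= fgh (nbhs_singleton fg).
apply/diff_locallyP.
by rewrite (diff_unique dfc gE).
Qed.

Lemma mulmx_entryE (p q r : nat) (f : V -> 'M[R]_(p, q)) (g : V -> 'M[R]_(q, r)) a c :
  (fun y => (f y *m g y) a c) = \sum_(b < q) (fun y => f y a b * g y b c).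
Proof. by apply/funext => y; rewrite fct_sumE mxE. Qed.

Lemma derivable_mulmx (p q r : nat) (f : V -> 'M[R]_(p, q)) (g : V -> 'M[R]_(q, r))
  (x v : V) : derivable f x v -> derivable g x v ->
  derivable (fun y => f y *m g y) x v.
Proof.
move=> /derivable_mxP df /derivable_mxP dg; apply/derivable_mxP => a c.
rewrite mulmx_entryE.
by apply: derivable_sum => b; apply: derivableM.
Qed.

Lemma derive_mulmx (p q r : nat) (f : V -> 'M[R]_(p, q)) (g : V -> 'M[R]_(q, r))
  (x v : V) : derivable f x v -> derivable g x v ->
  'D_v (fun y => f y *m g y) x = 'D_v f x *m g x + f x *m 'D_v g x.
Proof.
move=> df dg.
have df' := (derivable_mxP _ _ _).1 df; have dg' := (derivable_mxP _ _ _).1 dg.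
rewrite (derive_mx (derivable_mulmx df dg)) (derive_mx df) (derive_mx dg).
apply/matrixP => a c; rewrite !mxE.
rewrite mulmx_entryE.
rewrite derive_sum; last by move=> b; apply: derivableM.
rewrite addrC -big_split; apply: eq_bigr => b _ /=.
by rewrite !mxE deriveM //; congr (_ + _); rewrite [LHS]mulrC.
Qed.

Lemma differentiable_mulmx (p q r : nat) (f : V -> 'M[R]_(p, q))
  (g : V -> 'M[R]_(q, r)) (x : V) : differentiable f x -> differentiable g x ->
  differentiable (fun y => f y *m g y) x.
Proof.
move=> /differentiable_mxP df /differentiable_mxP dg.
apply/differentiable_mxP => a c.
rewrite mulmx_entryE.
by apply: differentiable_sum => b; apply: differentiableM.
Qed.

Lemma derivable_trmx (p q : nat) (f : V -> 'M[R]_(p, q)) (x v : V) :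
  derivable f x v -> derivable (fun y => (f y)^T) x v.
Proof.
move=> /derivable_mxP df; apply/derivable_mxP => a b.
by under eq_fun do rewrite mxE; exact: df.
Qed.

Lemma derive_trmx (p q : nat) (f : V -> 'M[R]_(p, q)) (x v : V) :
  derivable f x v -> 'D_v (fun y => (f y)^T) x = ('D_v f x)^T.
Proof.
move=> df; rewrite (derive_mx (derivable_trmx df)) (derive_mx df).
by apply/matrixP => a b; rewrite !mxE; under eq_fun do rewrite mxE.
Qed.

Lemma differentiable_trmx (p q : nat) (f : V -> 'M[R]_(p, q)) (x : V) :
  differentiable f x -> differentiable (fun y => (f y)^T) x.
Proof.
move=> /differentiable_mxP df; apply/differentiable_mxP => a b.
by under eq_fun do rewrite mxE; exact: df.
Qed.

Lemma derivable_mxsub (p q p' q' : nat) (u : 'I_p' -> 'I_p) (v : 'I_q' -> 'I_q)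
  (f : V -> 'M[R]_(p, q)) (x w : V) :
  derivable f x w -> derivable (fun y => mxsub u v (f y)) x w.
Proof.
move=> /derivable_mxP df; apply/derivable_mxP => a b.
by under eq_fun do rewrite mxE; exact: df.
Qed.

Lemma derive_mxsub (p q p' q' : nat) (u : 'I_p' -> 'I_p) (v : 'I_q' -> 'I_q)
  (f : V -> 'M[R]_(p, q)) (x w : V) :
  derivable f x w -> 'D_w (fun y => mxsub u v (f y)) x = mxsub u v ('D_w f x).
Proof.
move=> df; rewrite (derive_mx (derivable_mxsub df)) (derive_mx df).
by apply/matrixP => a b; rewrite !mxE; under eq_fun do rewrite mxE.
Qed.

Lemma differentiable_mxsub (p q p' q' : nat) (u : 'I_p' -> 'I_p) (v : 'I_q' -> 'I_q)
  (f : V -> 'M[R]_(p, q)) (x : V) :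
  differentiable f x -> differentiable (fun y => mxsub u v (f y)) x.
Proof.
move=> /differentiable_mxP df; apply/differentiable_mxP => a b.
by under eq_fun do rewrite mxE; exact: df.
Qed.

End MatrixCalculus.

(** * Symmetry of mixed second derivatives *)

Section Schwarz.
Variables (R : realType) (V : normedModType R).

(** Both sides are limits of literally the same difference quotient. *)
Lemma derive_line (W : normedModType R) (f : V -> W) (a v : V) (t : R) :
  'D_v f (t *: v + a) = 'D_1 (fun s : R => f (s *: v + a)) t.
Proof.
rewrite /derive; set g1 := fun h => h^-1 *: _; set g2 := fun h => h^-1 *: _.
suff -> : g1 = g2 by [].
by apply/funext => h; rewrite /g1 /g2 /= [h%:A]mulr1 scalerDl addrA.
Qed.

Lemma derivable_line (W : normedModType R) (f : V -> W) (a v : V) (t : R) :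
  derivable f (t *: v + a) v -> derivable (fun s : R => f (s *: v + a)) t 1.
Proof.
rewrite /derivable; set g1 := fun h => h^-1 *: _; set g2 := fun h => h^-1 *: _.
suff -> : g1 = g2 by [].
by apply/funext => h; rewrite /g1 /g2 /= [h%:A]mulr1 scalerDl addrA.
Qed.

Definition second_difference (f : V -> R) (a u v : V) (h : R) : R :=
  f (h *: u + h *: v + a) - f (h *: u + a) - f (h *: v + a) + f a.

Lemma second_differenceC (f : V -> R) (a u v : V) (h : R) :
  second_difference f a u v h = second_difference f a v u h.
Proof. by rewrite /second_difference [h *: v + h *: u]addrC; ring. Qed.

(* Mean value theorem on s |-> f (a + s u + h v) - f (a + s u), followed by the
   first-order expansion of D_u f at a. *)
Lemma cvg_second_difference (f : V -> R) (a u v : V) :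
  (\near a, differentiable f a) -> differentiable ('D_u f) a ->
  (fun h : R => h^-1 ^+ 2 * second_difference f a u v h) @ 0^'+ --> 'D_v ('D_u f) a.
Proof.
move=> df dDf.
rewrite (deriveE v dDf).
set L := 'd ('D_u f) a.
apply/cvgrPdist_le => e e0.
(* Two remainders are estimated below, each by [e / c] times h (|u| + |v|); the factor 2 absorbs
   both, and the added 1 keeps [c] positive when u = v = 0. *)
pose c := (`|u| + `|v|) *+ 2 + 1.
have c0 : 0 < c by rewrite /c ltr_wpDl // mulrn_wge0 // addr_ge0.
have ec0 : 0 < e / c by rewrite divr_gt0.
have /eqaddoP/(_ _ ec0) DfE := diff_locally dDf.
have df0 : \forall w \near (0 : V), differentiable f (w + a).
  rewrite (near_shift a 0) /=.
  by apply: filterS df => y; rewrite /= sub0r subrK.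
have [r /= r0 rP] := (nbhs_ballP _ _).1 (filterI df0 DfE).
have rE w : `|w| < r -> differentiable f (w + a) /\
    `|'D_u f (w + a) - ('D_u f a + L w)| <= e / c * `|w|.
  move=> wr; have [|? Hw] := rP w.
    by rewrite -ball_normE /ball_ /= sub0r normrN.
  by split => //; exact: Hw.
near=> h.
have h0 : 0 < h by near: h; exact: nbhs_right_gt.
have hc : h * c < r.
  by rewrite -ltr_pdivlMr //; near: h; apply: nbhs_right_lt; rewrite divr_gt0.
have hh : 0 <= h <= h by rewrite lexx ltW.
have oh : 0 <= (0 : R) <= h by rewrite lexx ltW.
have small s t : 0 <= s <= h -> 0 <= t <= h -> `|s *: u + t *: v| <= h * (`|u| + `|v|).
  move=> /andP[s0 sh] /andP[t0 th]; rewrite (le_trans (ler_normD _ _)) //.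
  by rewrite !normrZ !ger0_norm // mulrDr lerD // ler_wpM2r.
have smallr s t : 0 <= s <= h -> 0 <= t <= h -> `|s *: u + t *: v| < r.
  move=> hs ht; rewrite (le_lt_trans (small _ _ hs ht)) // (le_lt_trans _ hc) //.
  rewrite ler_pM2l // /c mulr2n; have := normr_ge0 u; have := normr_ge0 v; lra.
pose phi (s : R) := f (s *: u + (h *: v + a)) - f (s *: u + a).
pose dphi (s : R) := 'D_u f (s *: u + (h *: v + a)) - 'D_u f (s *: u + a).
have dphiP s : 0 <= s <= h -> is_derive s 1 phi (dphi s).
  move=> hs; apply: is_deriveB; rewrite derive_line; apply: derivableP;
    apply: derivable_line; apply: diff_derivable.
  + by rewrite addrA; apply: (rE _ _).1; exact: smallr.
  + have := smallr s 0 hs oh; rewrite scale0r addr0 => H.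
    exact: (rE _ _).1.
have [||x xh phiE] := MVT_segment (ltW h0) (f := phi) (df := dphi).
- by move=> x; rewrite in_itv /= => /andP[x0 xh]; apply: dphiP; rewrite (ltW x0) ltW.
- apply: continuous_in_subspaceT => x; rewrite inE /= in_itv /= => xh.
  apply/differentiable_continuous/derivable1_diffP.
  by have [] := dphiP x xh.
have xh' : 0 <= x <= h by move: xh; rewrite in_itv.
have phi2 : second_difference f a u v h = dphi x * h.
  by move: phiE; rewrite /second_difference /phi !scale0r !add0r subr0 addrA => <-; ring.
rewrite phi2.
have -> : L v - h^-1 ^+ 2 * (dphi x * h) = h^-1 * (h * L v - dphi x).
  by field; rewrite gt_eqF.
rewrite normrM normfV (gtr0_norm h0) ler_pdivrMl //.
have x0 : `|x *: u| < r.
  by have := smallr x 0 xh' oh; rewrite scale0r addr0.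
have [_ H1] := rE _ (smallr x h xh' hh).
have [_ H2] := rE _ x0.
(* This is a difference of two first-order remainders of ['D_u f] at [a], for the increments x u + h
   v and x u: the value at [a] and L (x u) cancel, leaving h L v. *)
have -> : h * L v - dphi x =
    - ('D_u f (x *: u + h *: v + a) - ('D_u f a + L (x *: u + h *: v)))
    + ('D_u f (x *: u + a) - ('D_u f a + L (x *: u))).
  have -> : L (x *: u + h *: v) = L (x *: u) + h * L v.
    by rewrite linearD; congr (_ + _); rewrite linearZ.
  by rewrite /dphi !addrA; ring.
rewrite (le_trans (ler_normD _ _)) // normrN.
rewrite (le_trans (lerD H1 H2)) //.
have H3 := small x h xh' hh.
have H4 : `|x *: u| <= h * (`|u| + `|v|).
  by have := small x 0 xh' oh; rewrite scale0r addr0.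
rewrite -mulrDr mulrAC ler_pdivrMr // -mulrA [h * _]mulrCA ler_pM2l //.
by rewrite (le_trans (lerD H3 H4)) // -mulrDr ler_pM2l // /c mulr2n lerDl.
Unshelve. all: by end_near. Qed.

(** The second difference is symmetric in [u] and [v], so both mixed derivatives are the limit of
    one and the same function. *)
Lemma schwarz (f : V -> R) (a u v : V) :
  (\near a, differentiable f a) -> differentiable ('D_u f) a ->
  differentiable ('D_v f) a -> 'D_v ('D_u f) a = 'D_u ('D_v f) a.
Proof.
move=> df du dv.
have uv := cvg_second_difference (v := v) df du.
have vu := cvg_second_difference (v := u) df dv.
rewrite -(cvg_lim _ uv) // -(cvg_lim _ vu) //.
by under eq_fun do rewrite second_differenceC.
Qed.

End Schwarz.

(** * Maps of finite differentiability order and their closure properties *)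

Section SmoothMaps.
Variables (R : realType) (m : nat) (U : set 'rV[R]_m).
Hypothesis openU : open U.

Lemma iter_pd_rcons (V : normedModType R) (f : 'rV[R]_m -> V) s i :
  iter_pd R (rcons s i) f = iter_pd R s (pd R i f).
Proof. by elim: s => //= j s ->. Qed.

(** The recursion peels off the innermost derivative, whereas [iter_pd] adds the outermost one; only
    the former lets the product rule feed an induction on the order. *)
Fixpoint C_on (V : normedModType R) (r : nat) (f : 'rV[R]_m -> V) : Prop :=
  (forall x, U x -> differentiable f x) /\
  if r is r'.+1 then forall i, C_on r' (pd R i f) else True.

Lemma C_on_differentiable (V : normedModType R) r (f : 'rV[R]_m -> V) x :
  C_on r f -> U x -> differentiable f x.
Proof. by case: r => [|r] [df _]; exact: df. Qed.

Lemma C_onW (V : normedModType R) r (f : 'rV[R]_m -> V) : C_on r.+1 f -> C_on r f.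
Proof.
elim: r f => [|r IH] f [df dpf]; split => // i; exact/IH/dpf.
Qed.

Lemma smooth_onP (V : normedModType R) (f : 'rV[R]_m -> V) :
  smooth_on R U f <-> forall r, C_on r f.
Proof.
split=> [sf r | Cf s].
  elim: r f sf => [|r IH] f sf; split; first exact: (sf [::]).
  - by [].
  - exact: (sf [::]).
  - by move=> i; apply: IH => s x Ux; rewrite -iter_pd_rcons; exact: sf.
elim/last_ind: s f Cf => [|s i IH] f Cf x Ux; first exact: C_on_differentiable (Cf 0) Ux.
rewrite iter_pd_rcons; apply: IH => // r.
by have [_] := Cf r.+1; apply.
Qed.

Lemma near_open (P : 'rV[R]_m -> Prop) x : U x -> (forall y, U y -> P y) ->
  \near x, P x.
Proof. by move=> Ux UP; apply: filterS (open_nbhs_nbhs (conj openU Ux)). Qed.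

Lemma pd_eq_on (V : normedModType R) (f g : 'rV[R]_m -> V) i x :
  (forall y, U y -> f y = g y) -> U x -> pd R i f x = pd R i g x.
Proof. by move=> fg Ux; apply: near_eq_derive; exact: near_open. Qed.

Lemma C_on_ext (V : normedModType R) r (f g : 'rV[R]_m -> V) :
  (forall x, U x -> f x = g x) -> C_on r f -> C_on r g.
Proof.
elim: r f g => [|r IH] f g fg [df dpf]; split => //.
- by move=> x Ux; apply: near_eq_differentiable (df x Ux); exact: near_open.
- by move=> x Ux; apply: near_eq_differentiable (df x Ux); exact: near_open.
- by move=> i; apply: IH (dpf i) => x; exact: pd_eq_on.
Qed.

Lemma C_on_cst (V : normedModType R) r (a : V) : C_on r (fun=> a).
Proof.
elim: r a => [|r IH] a; split => // i.
by apply: C_on_ext (IH 0) => x Ux; rewrite /pd derive_cst.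
Qed.

Lemma C_onD (V : normedModType R) r (f g : 'rV[R]_m -> V) :
  C_on r f -> C_on r g -> C_on r (fun x => f x + g x).
Proof.
elim: r f g => [|r IH] f g [df dpf] [dg dpg]; split => //.
- by move=> x Ux; apply: differentiableD; [exact: df|exact: dg].
- by move=> x Ux; apply: differentiableD; [exact: df|exact: dg].
move=> i; apply: C_on_ext (IH _ _ (dpf i) (dpg i)) => x Ux.
by rewrite /pd -deriveD //; apply: diff_derivable; [exact: df|exact: dg].
Qed.

Lemma C_onN (V : normedModType R) r (f : 'rV[R]_m -> V) :
  C_on r f -> C_on r (fun x => - f x).
Proof.
elim: r f => [|r IH] f [df dpf]; split => //.
- by move=> x Ux; apply: differentiableN; exact: df.
- by move=> x Ux; apply: differentiableN; exact: df.
move=> i; apply: C_on_ext (IH _ (dpf i)) => x Ux.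
by rewrite /pd -deriveN //; apply: diff_derivable; exact: df.
Qed.

Lemma pd_mulmx (p q s : nat) (f : 'rV[R]_m -> 'M[R]_(p, q))
  (g : 'rV[R]_m -> 'M[R]_(q, s)) i x :
  differentiable f x -> differentiable g x ->
  pd R i (fun y => f y *m g y) x = pd R i f x *m g x + f x *m pd R i g x.
Proof. by move=> df dg; apply: derive_mulmx; exact: diff_derivable. Qed.

Lemma C_on_mulmx (p q s : nat) r (f : 'rV[R]_m -> 'M[R]_(p, q))
  (g : 'rV[R]_m -> 'M[R]_(q, s)) :
  C_on r f -> C_on r g -> C_on r (fun x => f x *m g x).
Proof.
elim: r f g => [|r IH] f g Cf Cg.
  split=> // x Ux.
  exact: differentiable_mulmx (C_on_differentiable Cf Ux) (C_on_differentiable Cg Ux).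
have df x (Ux : U x) := C_on_differentiable Cf Ux.
have dg x (Ux : U x) := C_on_differentiable Cg Ux.
split=> [x Ux|i]; first by apply: differentiable_mulmx; [exact: df|exact: dg].
have Cfg := C_onD (IH _ _ (Cf.2 i) (C_onW Cg)) (IH _ _ (C_onW Cf) (Cg.2 i)).
by apply: C_on_ext Cfg => x Ux; rewrite pd_mulmx //; [exact: df|exact: dg].
Qed.

Lemma C_on_trmx (p q : nat) r (f : 'rV[R]_m -> 'M[R]_(p, q)) :
  C_on r f -> C_on r (fun x => (f x)^T).
Proof.
elim: r f => [|r IH] f [df dpf]; split => //.
- by move=> x Ux; apply: differentiable_trmx; exact: df.
- by move=> x Ux; apply: differentiable_trmx; exact: df.
move=> i; apply: C_on_ext (IH _ (dpf i)) => x Ux.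
by rewrite /pd derive_trmx //; apply: diff_derivable; exact: df.
Qed.

(** Bootstrap: once [f] has order r, so has the product of [f] with [w i], which is the derivative
    of [f]; hence [f] has order r+1. *)
Lemma C_on_linear_ode (p q : nat) (f : 'rV[R]_m -> 'M[R]_(p, q))
  (w : 'I_m -> 'rV[R]_m -> 'M[R]_q) :
  (forall x, U x -> differentiable f x) ->
  (forall i r, C_on r (w i)) ->
  (forall i x, U x -> pd R i f x = f x *m w i x) -> forall r, C_on r f.
Proof.
move=> df Cw fE; elim=> [|r IH]; split => // i.
by apply: C_on_ext (C_on_mulmx IH (Cw i r)) => x Ux; rewrite fE.
Qed.

End SmoothMaps.

(** * Complex derivatives read along the real axis *)

Section RealAxis.
Variable R : realType.

Lemma normc_ge_Im (z : R[i]) : ((`|complex.Im z|)%:C)%C <= `|z|.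
Proof.
rewrite normc_def lecR -sqrtr_sqr ler_wsqrtr //.
by rewrite lerDr sqr_ge0.
Qed.

(** The limit over complex h may be taken along real h. Since |Re z| and |Im z| are at most |z|, the
    real quotients tend to Re L, and their vanishing imaginary part forces Im L = 0. *)
Lemma cvg_real_axis (q : R[i]^o -> R[i]^o) (L : R[i]^o) (qr : R -> R) :
  q h @[h --> 0^'] --> L -> (forall h : R, q (h%:C)%C = ((qr h)%:C)%C) ->
  (qr @ 0^' --> complex.Re L) /\ complex.Im L = 0.
Proof.
move=> qL qE.
have qrE e : 0 < e -> \forall h \near (0 : R)^', `|L - ((qr h)%:C)%C| < (e%:C)%C.
  move=> e0; have ec0 : 0 < (e%:C)%C :> R[i] by rewrite ltcE /= eqxx.
  have /cvgrPdist_lt/(_ _ ec0)[d /= d0 dP] := qL.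
  move: d0; rewrite ltcE /= => /andP[/eqP dI dR].
  (* A positive element of [R[i]] has zero imaginary part, so the radius can be compared with |h| in
     [R]. *)
  have dE : d = ((complex.Re d)%:C)%C by case: d dI {dR dP} => ? ? /= ->.
  near=> h; rewrite -qE; apply: dP.
    rewrite /ball_ /= sub0r normrN dE normc_def /= expr0n addr0 sqrtr_sqr ltcR.
    by near: h; exact: dnbhs0_lt.
  apply: contra_not_neq (_ : h <> 0) => [hc0|]; last first.
    by apply/eqP; near: h; exact: nbhs_dnbhs_neq.
  exact: (@complexI R h 0).
split.
  apply/cvgrPdist_lt => e e0; apply: filterS (qrE e e0) => h.
  have := normc_ge_Re (L - ((qr h)%:C)%C).
  by move=> /le_lt_trans/[apply]; rewrite ltcR; case: (L).
apply/eqP; rewrite -normr_le0; apply/ler_addgt0Pl => e e0; rewrite addr0.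
have [h] := @filter_ex _ _ (Proper_dnbhs_numFieldType (0 : R)) _ (qrE e e0).

have := normc_ge_Im (L - ((qr h)%:C)%C).
move=> /le_lt_trans/[apply]; rewrite ltcR => /ltW; apply: le_trans.
by case: (L) => x y /=; rewrite subr0.
Unshelve. all: by end_near. Qed.

Lemma derive_real_axis (p q : nat) (f : R[i]^o -> 'M[R[i]]_(p, q))
  (g : R -> 'M[R]_(p, q)) (t : R) :
  derivable f (t%:C)%C 1 -> (forall s : R, f (s%:C)%C = cmx R (g s)) ->
  derivable g t 1 /\ 'D_1 f (t%:C)%C = cmx R ('D_1 g t).
Proof.
move=> df fE.
pose Q (h : R[i]^o) := h^-1 *: (f (h *: 1 + (t%:C)%C) - f (t%:C)%C).
have QL : Q h @[h --> 0^'] --> 'D_1 f (t%:C)%C by exact: df.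
have main a b := cvg_real_axis
  (q := fun h => Q h a b) (L := 'D_1 f (t%:C)%C a b)
  (qr := fun h => h^-1 *: (g (h *: 1 + t) a b - g t a b)).
have {}main a b : (h^-1 *: (g (h *: 1 + t) a b - g t a b) @[h --> (0 : R)^'] -->
    complex.Re ('D_1 f (t%:C)%C a b)) /\ complex.Im ('D_1 f (t%:C)%C a b) = 0.
  apply: main.
    have := @coord_continuous R[i] p q a b ('D_1 f (t%:C)%C).
    exact: (cvg_comp Q (fun N : 'M[R[i]]_(p, q) => N a b) QL).
  move=> h; rewrite /Q !mxE.
  have -> : (h%:C)%C *: (1 : R[i]^o) + (t%:C)%C = ((h *: 1 + t)%:C)%C.
    by rewrite rmorphD /= ![_%:A]mulr1.
  by rewrite !fE !mxE -rmorphB -fmorphV -rmorphM.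
have dg : derivable g t 1.
  by apply/derivable_mxP => a b; apply/cvg_ex; eexists; exact: (main a b).1.
split=> //; apply/matrixP => a b; rewrite !mxE (derive_mx dg) mxE.
have [mR mI] := main a b.
have -> : 'D_1 (fun x => g x a b) t = complex.Re ('D_1 f (t%:C)%C a b).
  exact: cvg_lim mR.
by case: ('D_1 f (t%:C)%C a b) mI => x y /= ->.
Qed.

End RealAxis.

(** * Mixed derivatives of matrix maps; one-variable chain rules *)

Section MixedAndLineDerivatives.
Variables (R : realType) (V : normedModType R).

Lemma schwarz_mx (p q : nat) (f : V -> 'M[R]_(p, q)) (a u v : V) :
  (\near a, differentiable f a) -> differentiable ('D_u f) a ->
  differentiable ('D_v f) a -> 'D_v ('D_u f) a = 'D_u ('D_v f) a.
Proof.
move=> df du dv.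
(* Taking entries commutes with ['D_w] where [f] is differentiable, hence near [a]; this is enough,
   because an outer derivative sees only the germ. *)
have fE w i j : \near a, 'D_w f a i j = 'D_w (fun y => f y i j) a.
  by apply: filterS df => y dfy; rewrite (derive_mx (diff_derivable dfy)) mxE.
rewrite (derive_mx (diff_derivable (v := v) du)) (derive_mx (diff_derivable (v := u) dv)).
apply/matrixP => i j; rewrite [LHS]mxE [RHS]mxE.
rewrite (near_eq_derive v (fE u i j)) (near_eq_derive u (fE v i j)).
apply: schwarz.
- by apply: filterS df => y /differentiable_mxP.
- apply: near_eq_differentiable (fE u i j) _.
  by move/differentiable_mxP: du; apply.
- apply: near_eq_differentiable (fE v i j) _.
  by move/differentiable_mxP: dv; apply.
Qed.

Lemma derive_comp_opp (W : normedModType R) (f : R -> W) :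
  derivable f 0 1 -> 'D_1 (fun t => f (- t)) 0 = - 'D_1 f 0.
Proof.
move=> /derivable1_diffP df.
have -> : (fun t => f (- t)) = (fun t : R => f (t *: (- 1 : R) + 0)).
  by apply/funext => t; rewrite addr0 /GRing.scale /= mulrN1.
by rewrite -derive_line scale0r addr0 !deriveE // linearN.
Qed.

Lemma derivable_comp_opp (W : normedModType R) (f : R -> W) :
  derivable f 0 1 -> derivable (fun t => f (- t)) 0 1.
Proof.
move=> /derivable1_diffP df; apply/derivable1_diffP.
apply: differentiable_comp => //.
by rewrite oppr0.
Qed.

Lemma is_derive_affine (W : normedModType R) (a b : W) (t : R) :
  is_derive t 1 (fun s : R => a + s *: b) b.
Proof.
have ds : differentiable (fun s : R => s *: b) t by exact: differentiableZl.
apply: is_derive_eq.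
  apply: is_deriveD; exact: derivableP (diff_derivable ds).
by rewrite add0r deriveE // diffZl //= diff_val scale1r.
Qed.

End MixedAndLineDerivatives.

Lemma eq_oppmx (R : realType) (p q : nat) (X : 'M[R]_(p, q)) : X = - X -> X = 0.
Proof.
move=> /matrixP XN; apply/matrixP => a b; have := XN a b; rewrite !mxE; lra.
Qed.

(** * Matrix algebra *)
Section SignatureMatrix.
Variables (R : realType) (n k : nat).
Let J := Jmx R n k.

Lemma trmx_Jmx : J^T = J.
Proof. exact: tr_diag_mx. Qed.

Lemma mul_Jmx_Jmx : J *m J = 1%:M.
Proof.
rewrite /J /Jmx mulmx_diag; apply/matrixP => i j; rewrite !mxE.
by case: ifP => _; rewrite ?mulrNN mulr1.
Qed.

(** As J squares to 1, the group equation itself supplies an inverse polynomial in the entries of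
    [g], which the calculus rules can differentiate. *)
Lemma Opq_mx_invr (g : 'M[R]_n) : Opq_mx R n k g -> (J *m g^T *m J) *m g = 1%:M.
Proof. by move=> gO; rewrite -!mulmxA (mulmxA g^T) gO mul_Jmx_Jmx. Qed.

Lemma invmx_Opq (g : 'M[R]_n) : Opq_mx R n k g -> invmx g = J *m g^T *m J.
Proof.
move=> /Opq_mx_invr gO; have [_ gu] := mulmx1_unit gO.
by rewrite -[RHS]mulmx1 -(mulmxV gu) mulmxA gO mul1mx.
Qed.

Lemma mul_Gmx_Gmx : Gmx R n k *m Gmx R n k = 1%:M.
Proof.
rewrite /Gmx mulmx_block !(mulmx0, mul0mx, addr0, add0r) mulmx1 mul_Jmx_Jmx.
by rewrite -scalar_mx_block.
Qed.

Lemma unitmx_orthogonal_Gmx (C : comUnitRingType) (G A : 'M[C]_(n + n)) :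
  G *m G = 1%:M -> A^T *m G *m A = G -> A \in unitmx.
Proof.
move=> GG AG; have H : (G *m A^T *m G) *m A = 1%:M by rewrite -!mulmxA (mulmxA A^T) AG.
by have [] := mulmx1_unit H.
Qed.

End SignatureMatrix.

(** * Real matrices inside complex matrices *)

Section RealComplexMatrices.
Variable R : realType.

Lemma cmxM (p q s : nat) (A : 'M[R]_(p, q)) (B : 'M[R]_(q, s)) :
  cmx R (A *m B) = cmx R A *m cmx R B.
Proof. exact: (map_mxM (real_complex R)). Qed.

Lemma cmx_inj (p q : nat) : injective (@cmx R p q).
Proof.
move=> A B /matrixP AB; apply/matrixP => i j.
by apply: (@complexI R); have := AB i j; rewrite !mxE.
Qed.

Lemma cmxK (p q : nat) : cancel (@cmx R p q) (@ReM R p q).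
Proof. by move=> A; apply/matrixP => i j; rewrite !mxE. Qed.

Lemma cmxN (p q : nat) (A : 'M[R]_(p, q)) : cmx R (- A) = - cmx R A.
Proof. exact: (map_mxN (real_complex R)). Qed.

Lemma cmx1 (p : nat) : cmx R (1%:M : 'M[R]_p) = 1%:M.
Proof. exact: (map_mx1 (real_complex R)). Qed.

Lemma cmx_block (p1 p2 q1 q2 : nat) (A : 'M[R]_(p1, q1)) (B : 'M[R]_(p1, q2))
  (C : 'M[R]_(p2, q1)) (D : 'M[R]_(p2, q2)) :
  cmx R (block_mx A B C D) = block_mx (cmx R A) (cmx R B) (cmx R C) (cmx R D).
Proof. exact: map_block_mx. Qed.

Lemma cmx_invmx (p : nat) (A : 'M[R]_p) : cmx R (invmx A) = invmx (cmx R A).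
Proof. exact: (map_invmx (real_complex R)). Qed.

Lemma cmxZ (p q : nat) (a : R) (A : 'M[R]_(p, q)) :
  cmx R (a *: A) = (a%:C)%C *: cmx R A.
Proof. exact: (map_mxZ (real_complex R)). Qed.

Lemma cmx_conj_fixed (p q : nat) (A : 'M[R[i]]_(p, q)) :
  map_mx (fun z : R[i] => z^*) A = A -> A = cmx R (ReM R A).
Proof.
move=> /matrixP cA; apply/matrixP => i j; have := cA i j; rewrite !mxE.
case: (A i j) => a b [] /= /eqP; rewrite -subr_eq0 -opprD oppr_eq0 -mulr2n.
by rewrite mulrn_eq0 /= => /eqP ->.
Qed.

Lemma ReM_pdC (m p q : nat) (i : 'I_m) (f : 'rV[R]_m -> 'M[R[i]]_(p, q)) x :
  ReM R (pdC R i f x) = pd R i (fun y => ReM R (f y)) x.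
Proof.
apply/matrixP => a b; rewrite [LHS]mxE /pdC.
set P := pd R i _ x; set Q := pd R i _ x; rewrite !mxE.
by rewrite /= !(mul0r, mul1r, mulr0, subr0, addr0).
Qed.

End RealComplexMatrices.

(** * The extended frame along real lambda *)
Section FramePoint.
Variables (R : realType) (n : nat).

(** The point (x, t + 0i) of R^n x C, where [rshift n ord0] is the Re(lambda) co-ordinate. The shape
    t v + a makes it a line in t, ready for [derive_line]. *)
Definition frame_point (x : 'rV[R]_n) (t : R) : 'rV[R]_(n + 2) :=
  t *: delta_mx 0 (rshift n ord0) + row_mx x 0.

Lemma xpart_frame_point x t : xpart R (frame_point x t) = x.
Proof.
apply/rowP => j; rewrite /xpart /frame_point mxE [LHS]mxE [X in X + _]mxE.
by rewrite row_mxEl mxE /= eq_lrshift mulr0 add0r.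
Qed.

Lemma lpart_frame_point x t : lpart R (frame_point x t) = (t%:C)%C.
Proof.
rewrite /lpart /frame_point; congr (_ +i* _)%C.
  by rewrite mxE [LHS]mxE [X in X + _]mxE row_mxEr !mxE !eqxx mulr1 addr0.
by rewrite mxE [LHS]mxE [X in X + _]mxE row_mxEr !mxE /= eq_rshift mulr0 addr0.
Qed.

Lemma pd_frame_point (V : normedModType R) (f : 'rV[R]_(n + 2) -> V) x t i :
  pd R i (fun y => f (frame_point y t)) x = pd R (lshift 2 i) f (frame_point x t).
Proof.
have E h : frame_point (h *: delta_mx 0 i + x) t =
    h *: delta_mx 0 (lshift 2 i) + frame_point x t.
  rewrite /frame_point addrCA; congr (_ + _).
  by rewrite delta_mx_lshift scale_row_mx add_row_mx scaler0 addr0.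
rewrite /pd /derive; set g1 := fun h => h^-1 *: _; set g2 := fun h => h^-1 *: _.
suff -> : g1 = g2 by [].
by apply/funext => h; rewrite /g1 /g2 /= E.
Qed.

Lemma derive_frame_point (V : normedModType R) (f : 'rV[R]_(n + 2) -> V) x t :
  'D_1 (fun s => f (frame_point x s)) t = pd R (rshift n ord0) f (frame_point x t).
Proof. by rewrite /pd /frame_point derive_line. Qed.

Lemma derivable_frame_point (V : normedModType R) (f : 'rV[R]_(n + 2) -> V) x t :
  differentiable f (frame_point x t) -> derivable (fun s => f (frame_point x s)) t 1.
Proof. by move=> df; apply: derivable_line; exact: diff_derivable. Qed.

Lemma differentiable_frame_point t x : differentiable (frame_point^~ t) x.
Proof.
have -> : frame_point^~ t =
    (fun=> t *: delta_mx 0 (rshift n ord0)) \+ (fun y => y *m row_mx 1%:M 0).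
  by apply/funext => y; rewrite /= mul_mx_row mulmx1 mulmx0.
by apply: differentiableD => //; exact: differentiable_mulmx.
Qed.

End FramePoint.

Section ExtendedFrame.
Variables (R : realType) (n k : nat) (D : set 'rV[R]_n).
Variables (F : 'rV[R]_n -> 'M[R]_n) (E : 'rV[R]_n -> R[i] -> 'M[R[i]]_(n + n)).
Hypothesis openD : open D.
Hypothesis frameE : extended_frame R n k D F E.

Let J := Jmx R n k.
Let G := Gmx R n k.

Definition real_frame (x : 'rV[R]_n) (t : R) : 'M[R]_(n + n) := ReM R (E x (t%:C)%C).
Let M := real_frame.

(** Written as an affine function of t, so that its t-derivative, the inhomogeneous term of
    [pd_frame_jet], is the second block matrix. *)
Definition real_theta (t : R) (i : 'I_n) (x : 'rV[R]_n) : 'M[R]_(n + n) :=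
  block_mx (omega_form R n k F i x) 0 0 (tau_form R n k F i x)
  + t *: block_mx 0 (- (eii R i *m J)) (eii R i) 0.

Let P (p : 'rV[R]_(n + 2)) := ReM R (E (xpart R p) (lpart R p)).
Let DC : set 'rV[R]_(n + 2) := [set p | D (xpart R p)].

Lemma real_frameE x t : M x t = P (frame_point x t).
Proof. by rewrite /P xpart_frame_point lpart_frame_point. Qed.

Lemma open_frame_domain : open DC.
Proof.
by apply: open_comp openD => p _; exact: continuous_lsubmx.
Qed.

Lemma frame_domain_real x t : D x -> DC (frame_point x t).
Proof. by rewrite /DC /= xpart_frame_point. Qed.

Lemma frame_real x t : D x -> E x (t%:C)%C = cmx R (M x t).
Proof.
move=> Dx; have [_ [_ [_ [_ [_ [Ec _]]]]]] := frameE.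
apply: cmx_conj_fixed.
have tc : ((t%:C)%C : R[i])^* = (t%:C)%C.
  by apply/eqP; rewrite eq_complex /= oppr0 !eqxx.
by have := Ec x (t%:C)%C Dx; rewrite tc.
Qed.

Lemma real_frame_orthogonal x t : D x -> (M x t)^T *m G *m M x t = G.
Proof.
move=> Dx; have [_ [_ [_ [EG _]]]] := frameE.
apply: (@cmx_inj R); rewrite !cmxM -[RHS](EG x (t%:C)%C Dx) frame_real //.
by congr (_ *m _ *m _); apply/matrixP => a b; rewrite !mxE.
Qed.

Lemma real_frame_twist x t : D x -> Inn R n *m M x (- t) = M x t *m Inn R n.
Proof.
move=> Dx; have [_ [_ [_ [_ [_ [_ Et]]]]]] := frameE.
have II : Inn R n *m Inn R n = 1%:M.
  rewrite /Inn mulmx_block !(mulmx0, mul0mx, addr0, add0r) mulmx1 mulNmx mul1mx opprK.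
  by rewrite -scalar_mx_block.
have cII : cmx R (Inn R n) *m cmx R (Inn R n) = 1%:M by rewrite -cmxM II cmx1.
have [_ Iu] := mulmx1_unit cII.
apply: (@cmx_inj R); rewrite !cmxM -!frame_real //.
have := Et x (t%:C)%C Dx; rewrite -rmorphN => <-.
by rewrite mulmxKV.
Qed.

Lemma real_theta_cmx t i x : theta R n k F (t%:C)%C i x = cmx R (real_theta t i x).
Proof.
rewrite /theta /real_theta scale_block_mx add_block_mx !scaler0 !addr0 !add0r cmx_block.
rewrite -/J; congr block_mx; rewrite ?cmxZ //.
by rewrite cmxN scalerN scaleNr.
Qed.

Lemma real_frame_unit x t : D x -> M x t \in unitmx.
Proof.
move=> Dx; apply: unitmx_orthogonal_Gmx (real_frame_orthogonal t Dx).
exact: mul_Gmx_Gmx.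
Qed.

Lemma pd_real_frame x t i : D x -> pd R i (M^~ t) x = M x t *m real_theta t i x.
Proof.
move=> Dx; have [_ [_ [_ [EG [Eth _]]]]] := frameE.
have Eu : E x (t%:C)%C \in unitmx.
  by rewrite frame_real // map_unitmx real_frame_unit.
have := Eth x (t%:C)%C Dx i; rewrite real_theta_cmx => /(congr1 (mulmx (E x (t%:C)%C))).
rewrite mulmxA mulmxV // mul1mx frame_real // -cmxM => /(congr1 (@ReM R _ _)).
by rewrite ReM_pdC cmxK.
Qed.

Lemma smooth_ReM_frame : smooth_on R DC P.
Proof. by have [] := frameE. Qed.

Lemma derivable_real_frame x t : D x -> derivable (M x) t 1.
Proof.
move=> Dx; rewrite (_ : M x = fun s => P (frame_point x s)); last first.
  by apply/funext => s; rewrite real_frameE.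
apply: derivable_frame_point.
exact: (smooth_ReM_frame [::] (frame_domain_real t Dx)).
Qed.

Lemma differentiable_real_frame x t : D x -> differentiable (M^~ t) x.
Proof.
move=> Dx; rewrite (_ : M^~ t = P \o (fun y => frame_point y t)); last first.
  by apply/funext => s; rewrite /= real_frameE.
apply: differentiable_comp; first exact: differentiable_frame_point.
exact: (smooth_ReM_frame [::] (frame_domain_real t Dx)).
Qed.

(** A derivative along real lambda, so that it is a partial derivative on R^(n+2) and [schwarz_mx]
    applies; [derive_frame] identifies it with the complex derivative. *)
Definition frame_jet (x : 'rV[R]_n) : 'M[R]_(n + n) := 'D_1 (M x) 0.
Let A := frame_jet.

Lemma derive_frame x : D x ->
  'D_1 (E x : R[i]^o -> 'M[R[i]]_(n + n)) 0 = cmx R (A x).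
Proof.
move=> Dx; have [_ [_ [Eh _]]] := frameE.
exact: (derive_real_axis (t := 0) (Eh x Dx 0) (fun s => frame_real s Dx)).2.
Qed.

Let Pt := pd R (rshift n (ord0 : 'I_2)) P.

Lemma frame_jetE x : A x = Pt (frame_point x 0).
Proof.
rewrite /A /frame_jet (_ : M x = fun s => P (frame_point x s)).
  exact: derive_frame_point.
by apply/funext => s; exact: real_frameE.
Qed.

Lemma differentiable_frame_jet x : D x -> differentiable A x.
Proof.
move=> Dx; rewrite (_ : A = Pt \o (fun y => frame_point y 0)); last first.
  by apply/funext => s; rewrite /= frame_jetE.
apply: differentiable_comp; first exact: differentiable_frame_point.
exact: (smooth_ReM_frame [:: rshift n ord0] (frame_domain_real 0 Dx)).
Qed.

Lemma pd_frame_jet x i : D x -> pd R i A x =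
  A x *m real_theta 0 i x + M x 0 *m block_mx 0 (- (eii R i *m J)) (eii R i) 0.
Proof.
move=> Dx; have DCx t := frame_domain_real t Dx.
rewrite {1}(_ : A = fun y => Pt (frame_point y 0)); last first.
  by apply/funext => s; rewrite /= frame_jetE.
rewrite pd_frame_point /Pt /pd schwarz_mx; first last.
- exact: (smooth_ReM_frame [:: lshift 2 i] (DCx 0)).
- exact: (smooth_ReM_frame [:: rshift n ord0] (DCx 0)).
- exact: (near_open open_frame_domain (DCx 0) (smooth_ReM_frame [::])).
have := derive_frame_point (pd R (lshift 2 i) P) x 0; rewrite /pd => <-.
(* With x_i differentiated first, the frame equation can be inserted at every real s; the outer
   derivative then acts on a product. *)
rewrite (_ : (fun s => _) = (fun s => M x s *m real_theta s i x)); last first.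
  apply/funext => s; rewrite -pd_real_frame // (_ : M^~ s = fun y => P (frame_point y s)).
    by rewrite pd_frame_point.
  by apply/funext => y; rewrite real_frameE.
have [dth thE] : is_derive (0 : R) 1 (fun s => real_theta s i x) _ := is_derive_affine _ _ _.
rewrite (derive_mulmx (derivable_real_frame (t := 0) Dx) dth) thE.
exact: erefl.
Qed.

Lemma frame_jet_orthogonal x : D x -> (A x)^T *m G *m M x 0 + (M x 0)^T *m G *m A x = 0.
Proof.
move=> Dx; have dM := derivable_real_frame (t := 0) Dx.
have dMT := derivable_trmx dM.
have dMTG : derivable (fun t => (M x t)^T *m G) 0 1.
  exact: derivable_mulmx dMT (derivable_cst _ _ _).
have <- : 'D_1 (fun t => (M x t)^T *m G *m M x t) 0 = 0.
  rewrite (_ : (fun t => _) = cst G) ?derive_cst //.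
  by apply/funext => t; exact: real_frame_orthogonal.
rewrite (derive_mulmx dMTG dM) (derive_mulmx dMT (derivable_cst _ _ _)) derive_cst.
by rewrite mulmx0 addr0 (derive_trmx dM).
Qed.

(** The chain rule for t -> -t contributes a sign, which turns the commutation with [Inn] holding at
    order zero into anticommutation; this is what kills the diagonal blocks of the jet. *)
Lemma frame_jet_twist x : D x -> Inn R n *m A x = - (A x *m Inn R n).
Proof.
move=> Dx; have dM := derivable_real_frame (t := 0) Dx.
have dMN := derivable_comp_opp dM.
have twist : (fun t => Inn R n *m M x (- t)) = (fun t => M x t *m Inn R n).
  by apply/funext => t; exact: real_frame_twist.
have := congr1 (fun f : R -> 'M[R]_(n + n) => 'D_1 f 0) twist.
rewrite (derive_mulmx (derivable_cst _ _ _) dMN) (derive_mulmx dM (derivable_cst _ _ _)).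
rewrite !derive_cst (derive_comp_opp dM) mul0mx add0r mulmx0 addr0 mulmxN => <-.
by rewrite opprK.
Qed.

End ExtendedFrame.

(** * The frame and its first jet at lambda = 0 *)
Section FrameBlocks.
Variables (R : realType) (n k : nat) (D : set 'rV[R]_n).
Variables (F : 'rV[R]_n -> 'M[R]_n) (E : 'rV[R]_n -> R[i] -> 'M[R[i]]_(n + n)).
Hypothesis openD : open D.
Hypothesis frameE : extended_frame R n k D F E.

Local Notation J := (Jmx R n k).
Let M x := real_frame E x 0.
Let A := frame_jet E.

Definition frame_g1 x : 'M[R]_n := ulsubmx (M x).
Definition frame_g2 x : 'M[R]_n := drsubmx (M x).
Let g1 := frame_g1.
Let g2 := frame_g2.

(* The inverse of [g2 x] written as a polynomial in [g2 x], see [invmx_Opq]. *)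
Definition frame_Y x : 'M[R]_n := ursubmx (A x) *m (J *m (g2 x)^T *m J).
Let Y := frame_Y.

Lemma frame_zero x : D x -> M x = block_mx (g1 x) 0 0 (g2 x).
Proof.
move=> Dx; have := real_frame_twist frameE 0 Dx; rewrite oppr0 -/(M x).
rewrite -[M x]submxK /Inn !mulmx_block !(mulmx0, mul0mx, addr0, add0r).
rewrite !(mulmx1, mul1mx, mulmxN, mulNmx) => /eq_block_mx[_ urE dlE _].
by rewrite (eq_oppmx urE) (eq_oppmx (esym dlE)) /g1 /g2 /frame_g1 /frame_g2.
Qed.

Lemma frame_jet_block x : D x -> A x = block_mx 0 (ursubmx (A x)) (dlsubmx (A x)) 0.
Proof.
move=> Dx; have := frame_jet_twist frameE Dx; rewrite -/(A x).
rewrite -{1 2 3}[A x]submxK /Inn !mulmx_block !(mulmx0, mul0mx, addr0, add0r).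
rewrite !(mulmx1, mul1mx, mulmxN, mulNmx) opp_block_mx !opprK.
move=> /eq_block_mx[ulE _ _ drE].
by rewrite (eq_oppmx ulE) (eq_oppmx (esym drE)).
Qed.

Lemma frame_g12_orthogonal x : D x -> orthogonal_mx R (g1 x) /\ Opq_mx R n k (g2 x).
Proof.
move=> Dx; have := real_frame_orthogonal frameE 0 Dx; rewrite -/(M x) frame_zero //.
rewrite /Gmx tr_block_mx !mulmx_block !(trmx0, mulmx0, mul0mx, addr0, add0r, mulmx1).
by move=> /eq_block_mx[? _ _ ?].
Qed.

Lemma frame_g2_unit x : D x -> g2 x \in unitmx.
Proof. by move=> /frame_g12_orthogonal[_ /Opq_mx_invr/mulmx1_unit[]]. Qed.

Lemma frame_jet_dl x : D x -> dlsubmx (A x) = - (J *m (Y x)^T) *m g1 x.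
Proof.
move=> Dx; have [g1O g2O] := frame_g12_orthogonal Dx.
have := frame_jet_orthogonal frameE Dx.
rewrite -/(M x) -/(A x) frame_zero // frame_jet_block // /Gmx.
rewrite block_mxKdl; set B := ursubmx _; set C := dlsubmx _.
rewrite !tr_block_mx !mulmx_block !(trmx0, mulmx0, mul0mx, addr0, add0r, mulmx1).
rewrite add_block_mx !(addr0, add0r) -[X in _ = X]block_mx0 => /eq_block_mx[_ _ dlE _].
(* The transposed group equation, obtained by turning the left inverse J g2^T J into a right
   inverse. It makes g2 J the inverse of g2^T J, so that [dlE] can be solved for [C]. *)
have g2J : g2 x *m J *m (g2 x)^T = J.
  have /mulmx1C := Opq_mx_invr g2O.
  rewrite !mulmxA => /(congr1 (mulmx^~ J)); rewrite mul1mx -(mulmxA _ J J).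
  by rewrite mul_Jmx_Jmx mulmx1.
rewrite /Y /frame_Y -/B !trmx_mul trmxK trmx_Jmx !mulmxA mul_Jmx_Jmx mul1mx mulNmx.
apply/esym/eqP; rewrite eqr_oppLR -addr_eq0 -(mulmxA _ B^T); apply/eqP.
have -> : C = g2 x *m J *m ((g2 x)^T *m J *m C).
  by rewrite !mulmxA g2J mul_Jmx_Jmx mul1mx.
by rewrite -mulmxDr dlE mulmx0.
Qed.

Lemma frame_ur x : D x -> ursubmx (A x) = Y x *m g2 x.
Proof.
move=> Dx; have [_ g2O] := frame_g12_orthogonal Dx.
by rewrite /Y /frame_Y -mulmxA Opq_mx_invr // mulmx1.
Qed.

Lemma frame_jet_mul_inv x : D x ->
  A x *m invmx (M x) = block_mx 0 (Y x) (- (J *m (Y x)^T)) 0.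
Proof.
move=> Dx; have Mu := real_frame_unit frameE 0 Dx.
apply: (canLR (mulmxK Mu)).
rewrite frame_jet_block // frame_ur // frame_jet_dl // -/(M x) frame_zero //.
by rewrite mulmx_block !(mulmx0, mul0mx, addr0, add0r).
Qed.

Lemma differentiable_frame_zero x : D x -> differentiable M x.
Proof.
by move=> Dx; exact: (differentiable_real_frame frameE 0 Dx).
Qed.

Lemma pd_frame_zero x i : D x -> pd R i M x =
  block_mx (g1 x *m omega_form R n k F i x) 0 0 (g2 x *m tau_form R n k F i x).
Proof.
move=> Dx; have -> := pd_real_frame frameE 0 i Dx.
rewrite -/(M x) frame_zero // /real_theta scale0r addr0 mulmx_block.
by rewrite !(mulmx0, mul0mx, addr0, add0r).
Qed.

Lemma differentiable_frame_g1 x : D x -> differentiable g1 x.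
Proof.
move=> Dx; rewrite (_ : g1 = fun y => mxsub (@lshift n n) (@lshift n n) (M y)).
  exact: differentiable_mxsub (differentiable_frame_zero Dx).
by apply/funext => y; exact: ulsubmxEsub.
Qed.

Lemma differentiable_frame_g2 x : D x -> differentiable g2 x.
Proof.
move=> Dx; rewrite (_ : g2 = fun y => mxsub (@rshift n n) (@rshift n n) (M y)).
  exact: differentiable_mxsub (differentiable_frame_zero Dx).
by apply/funext => y; exact: drsubmxEsub.
Qed.

Lemma pd_frame_g1 i x : D x -> pd R i g1 x = g1 x *m omega_form R n k F i x.
Proof.
move=> Dx; rewrite (_ : g1 = fun y => mxsub (@lshift n n) (@lshift n n) (M y)); last first.
  by apply/funext => y; exact: ulsubmxEsub.
have dM := diff_derivable (v := delta_mx 0 i) (differentiable_frame_zero Dx).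
transitivity (mxsub (@lshift n n) (@lshift n n) (pd R i M x)); first exact: (derive_mxsub _ _ dM).
by rewrite -!ulsubmxEsub (pd_frame_zero i Dx) block_mxKul.
Qed.

Lemma pd_frame_g2 i x : D x -> pd R i g2 x = g2 x *m tau_form R n k F i x.
Proof.
move=> Dx; rewrite (_ : g2 = fun y => mxsub (@rshift n n) (@rshift n n) (M y)); last first.
  by apply/funext => y; exact: drsubmxEsub.
have dM := diff_derivable (v := delta_mx 0 i) (differentiable_frame_zero Dx).
transitivity (mxsub (@rshift n n) (@rshift n n) (pd R i M x)); first exact: (derive_mxsub _ _ dM).
by rewrite -!drsubmxEsub (pd_frame_zero i Dx) block_mxKdr.
Qed.

Lemma differentiable_frame_ur x : D x -> differentiable (fun y => ursubmx (A y)) x.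
Proof.
move=> Dx; rewrite (_ : (fun _ => _) = fun y => mxsub (@lshift n n) (@rshift n n) (A y)).
  exact: differentiable_mxsub (differentiable_frame_jet frameE Dx).
by apply/funext => y; exact: ursubmxEsub.
Qed.

Lemma pd_frame_ur i x : D x -> pd R i (fun y => ursubmx (A y)) x =
  ursubmx (A x) *m tau_form R n k F i x - g1 x *m eii R i *m J.
Proof.
move=> Dx.
rewrite (_ : (fun _ => _) = fun y => mxsub (@lshift n n) (@rshift n n) (A y)); last first.
  by apply/funext => y; exact: ursubmxEsub.
have dA := diff_derivable (v := delta_mx 0 i) (differentiable_frame_jet frameE Dx).
transitivity (mxsub (@lshift n n) (@rshift n n) (pd R i A x)); first exact: (derive_mxsub _ _ dA).
rewrite -!ursubmxEsub (pd_frame_jet openD frameE i Dx).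
rewrite -/(A x) -/(M x) frame_zero // {1}frame_jet_block // /real_theta scale0r addr0.
rewrite !mulmx_block add_block_mx block_mxKur !(mulmx0, mul0mx, addr0, add0r).
by rewrite mulmxN mulmxA.
Qed.

Lemma differentiable_frame_Y x : D x -> differentiable Y x.
Proof.
move=> Dx; apply: differentiable_mulmx (differentiable_frame_ur Dx) _.
apply: differentiable_mulmx (differentiable_cst _ _).
apply: differentiable_mulmx (differentiable_cst _ _) _.
exact: differentiable_trmx (differentiable_frame_g2 Dx).
Qed.

(** tau takes values in the Lie algebra of O(n-k,k); this is the infinitesimal counterpart of the
    group equation for g2. *)
Lemma tau_form_skew i x : J *m (tau_form R n k F i x)^T = - (tau_form R n k F i x *m J).
Proof.
rewrite /tau_form linearD linearN /= !trmx_mul trmx_Jmx trmxK /eii trmx_delta.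
rewrite mulmxDr mulmxN mulmxDl mulNmx -!mulmxA mul_Jmx_Jmx mulmx1.
rewrite (mulmxA J J) mul_Jmx_Jmx mul1mx opprD opprK addrC; congr (_ + _).
by rewrite mulmx1 !mulmxA mul_Jmx_Jmx mul1mx.
Qed.

Lemma pd_frame_Y i x : D x -> pd R i Y x = - (g1 x *m eii R i *m J *m invmx (g2 x)).
Proof.
move=> Dx; have [_ g2O] := frame_g12_orthogonal Dx.
have dg2 := differentiable_frame_g2 Dx; have dg2T := differentiable_trmx dg2.
have dJg := differentiable_mulmx (differentiable_cst J x) dg2T.
have dJgJ := differentiable_mulmx dJg (differentiable_cst J x).
rewrite /Y /frame_Y (pd_mulmx i (differentiable_frame_ur Dx) dJgJ) (pd_frame_ur i Dx).
rewrite (pd_mulmx i dJg (differentiable_cst J x)).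
rewrite (pd_mulmx i (differentiable_cst J x) dg2T).
have pd_cst : pd R i (fun=> J) x = 0 by exact: derive_cst.
rewrite pd_cst mul0mx add0r mulmx0 addr0.
rewrite (_ : pd R i (fun y => (g2 y)^T) x = (pd R i g2 x)^T); last first.
  exact: derive_trmx (diff_derivable dg2).
(* Two terms contain tau, one from the upper right block of the jet and one from g2^T; by skewness
   they are opposite, and only the g1 term survives. *)
rewrite pd_frame_g2 // trmx_mul (mulmxA J) tau_form_skew mulNmx mulNmx mulmxN.
by rewrite mulmxDl (invmx_Opq g2O) mulNmx !mulmxA addrC /cst addKr.
Qed.

End FrameBlocks.

(** * Orthogonal co-ordinate systems *)
Section OrthogonalCoordinates.
Variables (R : realType) (n k : nat) (U : set 'rV[R]_n).
Variables (phi u : 'rV[R]_n -> 'cV[R]_n) (g : 'rV[R]_n -> 'M[R]_n).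
Hypothesis openU : open U.
Hypothesis smooth_phi : smooth_on R U phi.
Hypothesis orth_g : forall x, U x -> orthogonal_mx R (g x).
Hypothesis pd_phi : forall x i, U x ->
  pd R i phi x = (- u x i 0) *: (g x *m delta_mx i 0).
Hypothesis u_neq0 : forall x i, U x -> u x i 0 != 0.

Lemma dotv_pd x i j : U x ->
  dotv R (pd R i phi x) (pd R j phi x) = u x i 0 * u x j 0 *+ (i == j).
Proof.
move=> Ux; rewrite !pd_phi // /dotv [(_ *: _)^T]linearZ /= -scalemxAl -scalemxAr scalerA mulrNN.
rewrite trmx_mul -mulmxA (mulmxA (g x)^T) orth_g // mul1mx trmx_delta.
by rewrite mul_delta_mx_cond mxE mulmxnE mxE mulrnAr !eqxx mulr1.
Qed.

Lemma metric_field_frame : metric_field R U phi u.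
Proof.
move=> x Ux; apply/matrixP => i j; rewrite mxE dotv_pd // !mxE.
by case: eqP => // ->; rewrite expr2.
Qed.

Lemma orth_coord_frame : orth_coord R U phi.
Proof.
split=> //; split=> // x Ux; split=> [i|i j ij]; last first.
  by rewrite dotv_pd // (negbTE ij).
apply/eqP => pd0; have := dotv_pd i i Ux; rewrite pd0 /dotv mulmx0 mxE eqxx mulr1n.
by move/esym/eqP; rewrite mulf_eq0 orbb (negbTE (u_neq0 i Ux)).
Qed.

Lemma guichard_frame : (forall x, U x -> null_vector R n k (u x)) -> guichard R n k U phi.
Proof.
move=> u0 x Ux; have muE := metric_field_frame Ux.
split; first by rewrite muE diag_mx_is_diag.
have gE i : pullback_metric R phi x i i = u x i 0 ^+ 2 by rewrite muE !mxE eqxx.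
under eq_bigr do rewrite gE; under [in RHS]eq_bigr do rewrite gE.
have := u0 x Ux; rewrite /null_vector /formk /Jmx mul_mx_diag mxE.
rewrite (bigID (fun i : 'I_n => (i < n - k)%N)) /=.
under eq_bigr => i ik do rewrite !mxE ik mulr1 -expr2.
under [X in _ + X]eq_bigr => i ik do rewrite !mxE (negbTE ik) mulrN1 mulNr -expr2.
rewrite sumrN => /eqP; rewrite subr_eq0 => /eqP ->.
by apply: eq_bigl => i; rewrite -leqNgt.
Qed.

End OrthogonalCoordinates.

(** * Smoothness, metric and Combescure property of the maps Y c *)

Section FrameCoordinates.
Variables (R : realType) (n k : nat) (D : set 'rV[R]_n).
Variables (F : 'rV[R]_n -> 'M[R]_n) (E : 'rV[R]_n -> R[i] -> 'M[R[i]]_(n + n)).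
Hypothesis openD : open D.
Hypothesis smoothF : smooth_on R D F.
Hypothesis frameE : extended_frame R n k D F E.

Local Notation J := (Jmx R n k).
Let g1 := frame_g1 E.
Let g2 := frame_g2 E.
Let Y := frame_Y k E.

Lemma C_on_omega i r : C_on D r (omega_form R n k F i).
Proof.
have CF := (smooth_onP _ _).1 smoothF r.
have Ccst (p q : nat) (X : 'M[R]_(p, q)) := C_on_cst openD r X.
apply: C_onD => //.
  by apply: C_onN => //; apply: C_on_mulmx.
by apply: C_on_mulmx => //; apply: C_on_mulmx => //; exact: C_on_trmx.
Qed.

Lemma C_on_tau i r : C_on D r (tau_form R n k F i).
Proof.
have CF := (smooth_onP _ _).1 smoothF r.
have Ccst (p q : nat) (X : 'M[R]_(p, q)) := C_on_cst openD r X.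
apply: C_onD => //.
  apply: C_onN => //; apply: C_on_mulmx => //; apply: C_on_mulmx => //.
  exact: C_on_trmx.
by do 2!apply: C_on_mulmx => //.
Qed.

Lemma C_on_g1 r : C_on D r g1.
Proof.
apply: (C_on_linear_ode openD _ C_on_omega) => [x Dx|i x Dx].
  exact: (differentiable_frame_g1 frameE Dx).
exact: (pd_frame_g1 frameE i Dx).
Qed.

Lemma C_on_g2 r : C_on D r g2.
Proof.
apply: (C_on_linear_ode openD _ C_on_tau) => [x Dx|i x Dx].
  exact: (differentiable_frame_g2 frameE Dx).
exact: (pd_frame_g2 frameE i Dx).
Qed.

(** The derivatives of Y no longer involve the jet: they are polynomial in g1 and g2, whose
    smoothness is already known. *)
Lemma smooth_frame_Y : smooth_on R D Y.
Proof.
apply/smooth_onP => -[|r]; split => //;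
  try by move=> x Dx; exact: (differentiable_frame_Y frameE Dx).
move=> i.
have Ccst (p q : nat) (X : 'M[R]_(p, q)) := C_on_cst openD r X.
apply: (C_on_ext openD (f := fun x => - (g1 x *m eii R i *m J *m (J *m (g2 x)^T *m J)))).
  move=> x Dx; rewrite (pd_frame_Y openD frameE i Dx).
  by have [_ /invmx_Opq ->] := frame_g12_orthogonal frameE Dx.
apply: C_onN => //; apply: C_on_mulmx => //.
  by do 2!apply: C_on_mulmx => //; exact: C_on_g1.
by do 2!apply: C_on_mulmx => //; apply: C_on_trmx => //; exact: C_on_g2.
Qed.

Definition frame_metric (c : 'cV[R]_n) x : 'cV[R]_n := J *m invmx (g2 x) *m c.

Lemma smooth_coord (c : 'cV[R]_n) : smooth_on R D (fun x => Y x *m c).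
Proof.
apply/smooth_onP => r; apply: C_on_mulmx => //; last exact: C_on_cst.
exact: (smooth_onP _ _).1 smooth_frame_Y r.
Qed.

Lemma pd_coord (c : 'cV[R]_n) x i : D x -> pd R i (fun y => Y y *m c) x =
  (- frame_metric c x i 0) *: (g1 x *m delta_mx i 0).
Proof.
move=> Dx.
rewrite (pd_mulmx i (differentiable_frame_Y frameE Dx) (differentiable_cst c x)).
rewrite (_ : pd R i (fun=> c) x = 0); last exact: derive_cst.
rewrite mulmx0 addr0 (pd_frame_Y openD frameE i Dx) mulNmx scaleNr; congr (- _).
(* It remains to see that e_ii v is the i-th entry of v times the i-th basis vector. *)
rewrite -!mulmxA scalemxAr; congr (_ *m _); rewrite /frame_metric -/g2 -mulmxA.
apply/matrixP => a b; rewrite ord1 [RHS]mxE (mxE _ _ a) /eii mxE (bigD1 i) //=.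
rewrite big1 ?addr0 => [|j ji]; first by rewrite !mxE eqxx andbT mulrC.
by rewrite !mxE (negbTE ji) andbF mul0r.
Qed.

Lemma null_frame_metric (c : 'cV[R]_n) x :
  D x -> null_vector R n k c -> null_vector R n k (frame_metric c x).
Proof.
move=> Dx c0; have [_ g2O] := frame_g12_orthogonal frameE Dx.
have g2u := frame_g2_unit frameE Dx.
rewrite /null_vector -[RHS]c0 /formk; congr (_ 0 0).
rewrite /frame_metric !trmx_mul trmx_Jmx -!mulmxA; congr (_ *m _).
rewrite (mulmxA J J) mul_Jmx_Jmx mul1mx !mulmxA; congr (_ *m _).
(* Writing the inner J as g2^T J g2 cancels both inverses: g2^-1 preserves the form as g2 does. *)
rewrite -{1}g2O trmx_inv !mulmxA mulVmx ?unitmx_tr // mul1mx.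
by rewrite -mulmxA mulmxV // mulmx1.
Qed.

Lemma continuous_frame_metric (c : 'cV[R]_n) j x :
  D x -> {for x, continuous (fun y => frame_metric c y j 0)}.
Proof.
move=> Dx; apply: differentiable_continuous.
(* [invmx] is traded for the polynomial inverse; the two agree only on D, hence the passage to
   germs. *)
apply: (near_eq_differentiable (f := fun y => (J *m (J *m (g2 y)^T *m J) *m c) j 0)).
  apply: (near_open openD Dx) => y Dy.
  by have [_ /invmx_Opq g2E] := frame_g12_orthogonal frameE Dy; rewrite /frame_metric g2E.
have dg2T := differentiable_trmx (differentiable_frame_g2 frameE Dx).
have dJ := differentiable_cst (J : 'M[R]_n) x.
have dc := differentiable_cst c x.
exact: (differentiable_mxP _ _).1 (differentiable_mulmx (differentiable_mulmx dJ
  (differentiable_mulmx (differentiable_mulmx dJ dg2T) dJ)) dc) j 0.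
Qed.

(** A finite index type treats a single vector, a pair and a whole basis alike; finiteness lets the
    finitely many neighbourhoods be intersected. *)
Lemma open_frame_metric_neq0 (I : finType) (cs : I -> 'cV[R]_n) :
  open [set x | D x /\ forall a j, frame_metric (cs a) x j 0 != 0].
Proof.
rewrite openE => x [Dx ux]; rewrite /interior /=.
have nz : \near x, forall a j, frame_metric (cs a) x j 0 != 0.
  apply: (@filter_forall _ _ (fun a y => forall j, frame_metric (cs a) y j 0 != 0) (nbhs x) _) => a.
  apply: (@filter_forall _ _ (fun j y => frame_metric (cs a) y j 0 != 0) (nbhs x) _) => j.
  have /cvgrPdist_lt/(_ `|frame_metric (cs a) x j 0|) := continuous_frame_metric (c := cs a) (j := j) Dx.
  rewrite normr_gt0 => /(_ (ux a j)); apply: filterS => y.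
  by apply: contraTneq => ->; rewrite subr0 ltxx.
by apply: filterS2 (open_nbhs_nbhs (conj openD Dx)) nz => y.
Qed.

Lemma frame_orth_coord (U : set 'rV[R]_n) (c : 'cV[R]_n) :
  open U -> U `<=` D -> (forall x j, U x -> frame_metric c x j 0 != 0) ->
  orth_coord R U (fun x => Y x *m c) /\ metric_field R U (fun x => Y x *m c) (frame_metric c).
Proof.
move=> openU UD c_neq0.
have orthg x (Ux : U x) := (frame_g12_orthogonal frameE (UD x Ux)).1.
have pdY x i (Ux : U x) := pd_coord c i (UD x Ux).
split; last exact: (metric_field_frame orthg pdY).
have smoothU : smooth_on R U (fun x => Y x *m c).
  by move=> s x Ux; exact: (smooth_coord c s (UD x Ux)).
exact: (orth_coord_frame openU smoothU orthg pdY c_neq0).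
Qed.

Lemma frame_guichard (U : set 'rV[R]_n) (c : 'cV[R]_n) :
  U `<=` D -> null_vector R n k c -> guichard R n k U (fun x => Y x *m c).
Proof.
move=> UD c0.
have orthg x (Ux : U x) := (frame_g12_orthogonal frameE (UD x Ux)).1.
have pdY x i (Ux : U x) := pd_coord c i (UD x Ux).
apply: (guichard_frame orthg pdY) => x Ux.
exact: (null_frame_metric (UD x Ux) c0).
Qed.

Lemma frame_combescure (U : set 'rV[R]_n) (b c : 'cV[R]_n) :
  open U -> U `<=` D -> (forall x j, U x -> frame_metric b x j 0 != 0) ->
  (forall x j, U x -> frame_metric c x j 0 != 0) ->
  combescure R U (fun x => Y x *m b) (fun x => Y x *m c).
Proof.
move=> openU UD b_neq0 c_neq0.
split; first exact: (frame_orth_coord openU UD b_neq0).1.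
split; first exact: (frame_orth_coord openU UD c_neq0).1.
move=> x Ux j; exists (frame_metric c x j 0 / frame_metric b x j 0).
rewrite (pd_coord b j (UD x Ux)) (pd_coord c j (UD x Ux)) scalerA mulrN.
by rewrite divfK // b_neq0.
Qed.

End FrameCoordinates.

Theorem theorem3p2 (R : realType) (n k : nat)
  (hn : (2 <= n)%N) (hk1 : (1 <= k)%N) (hk2 : (k <= n - 1)%N)
  (D : set 'rV[R]_n) (hDo : open D) (hDsc : simply_connected R D)
  (F : 'rV[R]_n -> 'M[R]_n) (hF : solves_system R n k D F)
  (E : 'rV[R]_n -> R[i] -> 'M[R[i]]_(n + n))
  (hE : extended_frame R n k D F E) :
  exists (g1 g2 Y : 'rV[R]_n -> 'M[R]_n),
    (* (a) *)
    (forall x, D x ->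
       E x 0 = cmx R (block_mx (g1 x) 0 0 (g2 x)) /\
       orthogonal_mx R (g1 x) /\ Opq_mx R n k (g2 x)) /\
    (* (b) *)
    (forall x, D x ->
       'D_1 (E x : R[i]^o -> 'M[R[i]]_(n + n)) 0 *m invmx (E x 0)
         = cmx R (block_mx 0 (Y x) (- (Jmx R n k *m (Y x)^T)) 0) /\
       differentiable Y x /\
       (forall i, pd R i Y x = - (g1 x *m eii R i *m Jmx R n k *m invmx (g2 x)))) /\
    (* (c) *)
    (forall c : 'cV[R]_n, null_vector R n k c ->
       let u := fun x => Jmx R n k *m invmx (g2 x) *m c in
       let U := [set x | D x /\ \prod_(i < n) u x i 0 != 0] in
       let phi := fun x => Y x *m c in
       orth_coord R U phi /\ guichard R n k U phi /\ metric_field R U phi u) /\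
    (* (d) *)
    (forall cs : 'I_n -> 'cV[R]_n, null_basis R n k cs ->
       let U := [set x | D x /\
                   forall i j : 'I_n, (Jmx R n k *m invmx (g2 x) *m cs i) j 0 != 0] in
       combescure_seq R n k U (fun i x => Y x *m cs i)) /\
    (* (e) *)
    (forall cs bs : 'I_n -> 'cV[R]_n, null_basis R n k cs -> null_basis R n k bs ->
       forall i j : 'I_n,
       let U := [set x | D x /\
                   forall l : 'I_n, (Jmx R n k *m invmx (g2 x) *m cs i) l 0 != 0 /\
                                    (Jmx R n k *m invmx (g2 x) *m bs j) l 0 != 0] in
       combescure R U (fun x => Y x *m cs i) (fun x => Y x *m bs j)).
Proof.
have [smoothF _] := hF.
pose g1 := frame_g1 E; pose g2 := frame_g2 E; pose Y := frame_Y k E.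
have metricE c x : frame_metric k E c x = Jmx R n k *m invmx (g2 x) *m c by [].
exists g1, g2, Y; split; [|split; [|split; [|split]]].
- move=> x Dx; split; last exact: (frame_g12_orthogonal hE Dx).
  by rewrite -(frame_zero hE Dx); exact: (frame_real hE 0 Dx).
- move=> x Dx; split; last split; last by move=> i; exact: (pd_frame_Y hDo hE i Dx).
    rewrite (derive_frame hE Dx) -(frame_jet_mul_inv hE Dx) cmxM.
    by congr (_ *m _); rewrite cmx_invmx -(frame_real hE 0 Dx).
  exact: (differentiable_frame_Y hE Dx).
- move=> c c0 u U phi.
  have UD : U `<=` D by move=> x [].
  have u_neq0 x j : U x -> u x j 0 != 0 by move=> [_ /prodf_neq0]; exact.
  have openU : open U.
    (* A product in a field is non-zero exactly when every factor is; the one-element family then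
       gives openness. *)
    rewrite (_ : U = [set x | D x /\ forall (_ : unit) j, u x j 0 != 0]).
      exact: (open_frame_metric_neq0 hDo hE (cs := fun=> c)).
    apply/seteqP; split => x [Dx ux]; split => //; first by move=> _ j; exact: u_neq0.
    by apply/prodf_neq0 => j _; exact: ux tt j.
  have [? ?] := frame_orth_coord hDo smoothF hE openU UD u_neq0.
  by split=> //; split=> //; exact: (frame_guichard hDo hE UD c0).
- move=> cs [csF [_ cs0]] U.
  have UD : U `<=` D by move=> x [].
  have openU : open U := open_frame_metric_neq0 hDo hE (cs := cs).
  have cs_neq0 a x j : U x -> frame_metric k E (cs a) x j 0 != 0 by move=> [_]; exact.
  have csP a := frame_orth_coord hDo smoothF hE openU UD (cs_neq0 a).
  split=> [a|]; first by split; [exact: (csP a).1|exact: (frame_guichard hDo hE UD (cs0 a))].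
  split=> [a b _|].
    exact: (frame_combescure hDo smoothF hE openU UD (cs_neq0 a) (cs_neq0 b)).
  exists (fun a => frame_metric k E (cs a)); split; first by move=> a; exact: (csP a).2.
  split=> [a a0 j x _ Ux|x Ux].
    rewrite (pd_coord hDo hE (cs a) j (UD x Ux)) (pd_coord hDo hE (cs a0) j (UD x Ux)).
    (* Dividing by u_j leaves minus the j-th column of g1 for every member of the sequence, so these
       metric fields carry compatible signs. *)
    by rewrite !scalerA !mulrN !mulVf // cs_neq0.
  have g2u := frame_g2_unit hE (UD x Ux).
  have [_ Ju] := mulmx1_unit (mul_Jmx_Jmx R n k).
  (* The matrix of metric fields is the basis matrix times the transpose of J g2^-1, a product of
     two invertible matrices. *)
  rewrite (_ : \matrix_(i < n) _ =
    (\matrix_(i < n) (cs i)^T) *m (Jmx R n k *m invmx (g2 x))^T); last first.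
    by apply/row_matrixP => a; rewrite row_mul !rowK metricE trmx_mul.
  rewrite row_free_unit unitmx_mul -row_free_unit csF unitmx_tr unitmx_mul Ju.
  by rewrite unitmx_inv.
- move=> cs bs _ _ i j U.
  have UD : U `<=` D by move=> x [].
  have openU : open U.
    (* The two vectors form a family indexed by [bool]. *)
    rewrite (_ : U = [set x | D x /\ forall (t : bool) l,
        frame_metric k E (if t then cs i else bs j) x l 0 != 0]).
      exact: (open_frame_metric_neq0 hDo hE (cs := fun t : bool => if t then cs i else bs j)).
    apply/seteqP; split => x [Dx ux]; split => //.
      by move=> [] l; have [] := ux l.
    by move=> l; split; [exact: ux true l|exact: ux false l].
  apply: (frame_combescure hDo smoothF hE openU UD) => x l [_ ux].
    by have [] := ux l.
  by have [] := ux l.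
Qed.
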